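(* Let $n\ge 1$, let $A\subset\mathbb{R}^n$ be nonempty with convex hull $E=\operatorname{Co}(A)$, and let $h:E\to\mathbb{R}$ be an approximately convex function which is bounded above and which satisfies $h\le 0$ on $A$. Then $$\sup_{x\in E}h(x)\le [\log_2 n]+1+\frac{n}{2^{[\log_2 n]}}.$$ Moreover this is the sharp upper bound: for each $n\ge1$ the right-hand side cannot be replaced by any smaller number valid for all such $A$ and $h$.
   Context: A function $h:E\to\mathbb{R}$ on a convex set $E$ is approximately convex if $h\bigl(\frac{a+b}{2}\bigr)\le\frac{h(a)+h(b)}{2}+1$ for all $a,b\in E$. $[\,\cdot\,]$ is the greatest integer function. *)

(* Defs.v *)
From mathcomp Require Import all_boot all_order all_algebra.
From mathcomp Require Import all_classical all_reals all_analysis.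

Set Implicit Arguments.
Unset Strict Implicit.
Unset Printing Implicit Defensive.

Import Order.TTheory GRing.Theory Num.Theory.

Local Open Scope classical_set_scope.
Local Open Scope ring_scope.

Definition convex_hull (R : realType) (n : nat) (A : set 'rV[R]_n) :
    set 'rV[R]_n :=
  smallest (@convex_set R 'rV[R]_n) A.

(* A function on E is represented by a total function whose values outside E
   are irrelevant: E is convex in all uses, so the midpoint is again in E. *)
Definition approximately_convex (R : realType) (n : nat) (E : set 'rV[R]_n)
    (h : 'rV[R]_n -> R) : Prop :=
  forall a b, E a -> E b -> h (2^-1 *: (a + b)) <= (h a + h b) / 2 + 1.

Definition admissible (R : realType) (n : nat) (A : set 'rV[R]_n)
    (h : 'rV[R]_n -> R) : Prop :=
  [/\ A !=set0,
      approximately_convex (convex_hull A) h,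
      has_ubound [set h x | x in convex_hull A] &
      forall x, A x -> h x <= 0].

Definition floor_log2 (R : realType) (n : nat) : int :=
  Num.floor (ln (n%:R : R) / ln 2).

Definition kappa (R : realType) (n : nat) : R :=
  (floor_log2 R n)%:~R + 1 + n%:R / 2 ^ floor_log2 R n.

(* Main.v *)
Require Import Defs.
From mathcomp Require Import all_boot all_order all_algebra.
From mathcomp Require Import all_classical all_reals all_analysis.
From mathcomp Require Import ring lra.

Set Implicit Arguments.
Unset Strict Implicit.
Unset Printing Implicit Defensive.

Import Order.TTheory GRing.Theory Num.Theory.

Local Open Scope classical_set_scope.
Local Open Scope ring_scope.

(** Both halves of the theorem compute the same number
      S = sum over j >= 0 of min(2^j, n) / 2^j,
    whose terms are 1 as long as 2^j <= n and n / 2^j afterwards, so that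
    S = [log2 n] + 1 + n / 2^[log2 n] = kappa n.

    Upper bound.  By Caratheodory a point x of the hull is a barycentre of at
    most n + 1 points of A.  More generally, take a combination y of these
    points with nonnegative weights of integer total mass m, and try to write y
    as a sum of m points of the hull on which the sum of h is small.  The
    integer parts of the weights can be spent on points of A, where h <= 0.
    What is left has integer mass m', with m' <= m, and m' <= n because it is a
    sum of at most n + 1 fractional parts.  Split twice the remainder into 2 m'
    points and replace these, in pairs, by their midpoints: approximate
    convexity halves the sum of h and adds 1 for each of the m' pairs.  Starting
    from y = x and m = 1, the mass is at most min(2^j, n) after j doublings, and
    the costs m' / 2^j add up to at most S.  Because h is bounded above, the
    error made in stopping after N doublings is O(2^-N)
    ([splits_truncated_kappa]).

    Sharpness.  The same bookkeeping defines the extremal function.  On the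
    standard simplex let h(x) be the sum, over the n + 1 barycentric coordinates
    t of x, of sum_(j < N) frac(2^j t) / 2^j.  It vanishes at the vertices.
    Since frac is subadditive, and the sum for t / 2 is frac(t / 2) plus half
    the sum for t with one term less, a midpoint costs at most the total mass of
    the coordinates, which is 1 ([digit_depth_midpoint]).  To make every level
    j < N contribute min(2^j, n) / 2^j, move slightly below dyadic numbers:
    n coordinates are just under 1 / 2^(k+1) or 2 / 2^(k+1), with
    k = [log2 n], and the last one holds the tiny remainder.  Up to level k no
    coordinate has an integer part, and the fractional parts add up to 2^j; from
    level k + 1 on, n of the fractional parts are almost 1, and together with
    the last one they add up to n ([total_depth_extremal]). *)

(** * The constant as a series *)

Lemma floor_log2E (R : realType) (n : nat) : (0 < n)%N ->
  floor_log2 R n = (trunc_log 2 n)%:Z.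
Proof.
move=> n0; have /andP[lo hi] := trunc_log_bounds (isT : (1 < 2)%N) n0.
set k := trunc_log 2 n in lo hi *.
have ln2 : 0 < ln (2 : R) by rewrite ln_gt0 // ltr1n.
have lnX m : ln ((2 ^ m)%N%:R : R) = m%:R * ln 2.
  by rewrite natrX lnXn // mulr_natl.
have lnn : ln (n%:R : R) / ln 2 * ln 2 = ln n%:R by rewrite divfK // gt_eqF.
apply: floor_def; apply/andP; split.
  rewrite -(ler_pM2r ln2) lnn -lnX ler_ln ?posrE ?ltr0n ?expn_gt0 //.
  by rewrite ler_nat.
rewrite -(ltr_pM2r ln2) lnn -PoszD -[X in X * _]/((k + 1)%N%:R) -lnX.
by rewrite ltr_ln ?posrE ?ltr0n ?expn_gt0 // ltr_nat addn1.
Qed.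

(** The bound obtained after [N] doublings on the sum of [h] over [m] points:
    the mass that survives at level [j] is at most [2 ^ j * m], and at most
    [n]. *)
Definition truncated_kappa (R : realType) (n N m : nat) : R :=
  \sum_(j < N) (minn (2 ^ j * m) n)%:R / 2 ^+ j.

(** The terms are 1 up to [j = trunc_log 2 n] and [n / 2 ^ j] afterwards, and
    the [n / 2 ^ i] with [i > j] add up to [n / 2 ^ j]. *)
Lemma truncated_kappaE (R : realType) (n p : nat) : (0 < n)%N ->
  let k := trunc_log 2 n in
  truncated_kappa R n (k.+1 + p) 1 = kappa R n - n%:R / 2 ^+ (k + p).
Proof.
move=> n0 k; have /andP[lo hi] := trunc_log_bounds (isT : (1 < 2)%N) n0.
have two0 m : (2 : R) ^+ m != 0 by rewrite expf_neq0.
rewrite /kappa floor_log2E // -/k -exprnP /truncated_kappa.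
elim: p => [|p IHp].
  rewrite !addn0 addrK.
  rewrite (eq_bigr (fun=> 1)) => [|j _].
    by rewrite sumr_const card_ord -natr1.
  rewrite muln1 (minn_idPl _) ?natrX ?divff //.
  by apply: leq_trans lo; rewrite leq_exp2l // -ltnS.
rewrite !addnS big_ord_recr /= -addSn IHp muln1 (minn_idPr _); last first.
  by apply: leq_trans (ltnW hi) _; rewrite leq_exp2l // addSn ltnS leq_addr.
by rewrite addSn exprS invfM; field; rewrite !two0.
Qed.

(** One step of the recursion: [m'] is the mass kept at level 0, paid once for
    each midpoint, and [2 * m'] the mass handed over to the next level. *)
Lemma truncated_kappaS (R : realType) (n N m m' : nat) : (m' <= minn m n)%N ->
  m'%:R + truncated_kappa R n N (2 * m') / 2 <= truncated_kappa R n N.+1 m.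
Proof.
rewrite leq_min => /andP[m'm m'n].
rewrite /truncated_kappa big_ord_recl /= mul1n divr1 mulr_suml.
apply: lerD; first by rewrite ler_nat leq_min m'm.
apply: ler_sum => j _; rewrite /bump /= add1n exprSr invfM mulrA.
rewrite ler_pM2r ?invr_gt0 // ler_pM2r ?invr_gt0 ?exprn_gt0 // ler_nat.
by rewrite mulnA -expnSr leq_min geq_minr andbT geq_min leq_mul2l m'm orbT.
Qed.

Lemma div_exp2_lt (R : archiRealFieldType) (C e : R) : 0 < e ->
  exists p, forall q, (p <= q)%N -> C / 2 ^+ q < e.
Proof.
move=> e0; exists (Num.bound (C / e)) => q pq.
rewrite ltr_pdivrMr ?exprn_gt0 // -ltr_pdivrMl // mulrC.
exact: upper_nthrootP.
Qed.

(** * Convex combinations and Caratheodory's theorem *)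

Section ConvexCombinations.
Context (R : realType) (V : lmodType R).

Lemma convex_setE (C : set V) : convex_set (C : set (convex_lmodType V)) <->
  forall x y (t : R), 0 <= t <= 1 -> C x -> C y -> C (t *: x + (1 - t) *: y).
Proof.
split=> [cC x y t t01 Cx Cy|cC x y t].
  have /andP[t0 t1] := t01.
  have := cC x y (Itv01 t0 t1).
  by rewrite !inE; apply.
rewrite !inE => Cx Cy; apply: (cC x y t%:num) => //.
by rewrite ge0 le1.
Qed.

(** The weights need not sum to 1: normalizing at the end makes the statement
    an induction over partial sums, on the cone of the pairs [(t, v)] with [v]
    in [t] times [C]. *)
Lemma convex_sum (C : set V) (I : finType) (w : I -> R) (a : I -> V) :
    convex_set (C : set (convex_lmodType V)) ->
    (forall i, C (a i)) -> (forall i, 0 <= w i) -> 0 < \sum_i w i ->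
  C ((\sum_i w i)^-1 *: \sum_i w i *: a i).
Proof.
move=> /convex_setE cC Ca w0.
pose inCone (t : R) (v : V) := (t = 0 /\ v = 0) \/ (0 < t /\ C (t^-1 *: v)).
have: inCone (\sum_i w i) (\sum_i w i *: a i).
  apply: (big_ind2 inCone) => [|t u s v|i _]; first by left.
    move=> [[-> ->]|[t0 Cu]] [[-> ->]|[s0 Cv]]; rewrite ?addr0 ?add0r.
    - by left.
    - by right.
    - by right.
    have ts0 : 0 < t + s by rewrite addr_gt0.
    right; split=> //.
    have -> : (t + s)^-1 *: (u + v) =
        (t / (t + s)) *: (t^-1 *: u) + (1 - t / (t + s)) *: (s^-1 *: v).
      rewrite scalerDr !scalerA; congr (_ *: _ + _ *: _); field.
        by rewrite !gt_eqF.
      by rewrite !gt_eqF.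
    apply: cC => //; rewrite divr_ge0 ?(ltW t0) ?(ltW ts0) //=.
    rewrite ler_pdivrMr // mul1r lerDl.
    exact: ltW.
  have := w0 i; rewrite le_eqVlt => /predU1P[<-|wi].
    by left; rewrite scale0r.
  by right; split=> //; rewrite scalerK ?gt_eqF.
by move=> [[-> _]|[_]//]; rewrite ltxx.
Qed.

Definition convex_comb (A : set V) (m : nat) (x : V) : Prop :=
  exists (w : 'I_m -> R) (a : 'I_m -> V),
    [/\ forall i, 0 <= w i, forall i, A (a i), \sum_i w i = 1 &
        x = \sum_i w i *: a i].

Lemma convex_comb_convex (A : set V) :
  convex_set ([set x | exists m, convex_comb A m x] : set (convex_lmodType V)).
Proof.
apply/convex_setE => x y t /andP[t0 t1] [m [w [a [w0 Aa w1 ->]]]].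
move=> [p [u [b [u0 Ab u1 ->]]]].
exists (m + p)%N.
exists (fun i =>
  match fintype.split i with inl j => t * w j | inr j => (1 - t) * u j end).
exists (fun i => match fintype.split i with inl j => a j | inr j => b j end).
have spl j : fintype.split (lshift p j) = inl j by exact: (unsplitK (inl j)).
have spr j : fintype.split (rshift m j) = inr j by exact: (unsplitK (inr j)).
split=> [i|i||].
- by case: fintype.split => j; rewrite mulr_ge0 // subr_ge0.
- by case: fintype.split.
- rewrite big_split_ord /=; under eq_bigr do rewrite spl.
  under [X in _ + X]eq_bigr do rewrite spr.
  by rewrite -!mulr_sumr w1 u1 !mulr1 addrC subrK.
- rewrite big_split_ord /= !scaler_sumr; congr (_ + _).
    by apply: eq_bigr => j _; rewrite spl scalerA.
  by apply: eq_bigr => j _; rewrite spr scalerA.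
Qed.

End ConvexCombinations.

Section Caratheodory.
Context (R : realType) (n : nat).
Implicit Types (A : set 'rV[R]_n) (x : 'rV[R]_n).

(** The vectors [(a i, 1)] live in dimension [n + 1], so more than [n + 1] of
    them are linearly dependent; the last coordinate forces the coefficients to
    sum to 0, hence one of them is positive. *)
Lemma affine_dependence (m : nat) (a : 'I_m -> 'rV[R]_n) : (n.+1 < m)%N ->
  exists l : 'I_m -> R,
    [/\ \sum_i l i = 0, \sum_i l i *: a i = 0 & exists i, 0 < l i].
Proof.
move=> nm; pose M : 'M[R]_(m, n + 1) := row_mx (\matrix_i a i) (const_mx 1).
have : kermx M != 0.
  rewrite kermx_eq0 /row_free neq_ltn; apply/orP; left.
  by apply: leq_ltn_trans (rank_leq_col _) _; rewrite addn1.
case/rowV0Pn => v /sub_kermxP; rewrite mul_mx_row => vM v0.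
have [vA v1] : v *m (\matrix_i a i) = 0 /\ v *m (const_mx 1 : 'cV_m) = 0.
  by apply: eq_row_mx; rewrite vM row_mx0.
have s0 : \sum_i v 0 i = 0.
  have /matrixP/(_ 0 0) := v1; rewrite !mxE => v1E; rewrite -[RHS]v1E.
  by apply: eq_bigr => i _; rewrite !mxE mulr1.
exists (fun i => v 0 i); split=> //.
  rewrite -[RHS]vA; apply/rowP => j; rewrite summxE !mxE.
  by apply: eq_bigr => i _; rewrite !mxE.
apply/existsP; apply: contraNT v0 => /existsPn vn.
have vle i : 0 <= - v 0 i by rewrite oppr_ge0 leNgt.
apply/eqP/rowP => i; rewrite mxE; apply/eqP; rewrite -oppr_eq0.
suff /psumr_eq0P h : \sum_i - v 0 i = 0 by rewrite h.
by rewrite sumrN s0 oppr0.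
Qed.

(** Moving the weights along an affine dependence changes neither their sum nor
    the barycentre; stopping as soon as one of them reaches 0 keeps the others
    nonnegative. *)
Lemma convex_comb_shorten A (m : nat) x : (n < m)%N ->
  convex_comb A m.+1 x -> convex_comb A m x.
Proof.
move=> nm [w [a [w0 Aa w1 ->]]].
have [l [l0 la0 [i1 li1]]] := affine_dependence a (nm : (n.+1 < m.+1)%N).
pose r i := w i / l i.
(* [t] is the largest multiple of [l] that leaves all weights nonnegative. *)
have [i0 li0 rmin] :=
  @Order.TotalTheory.arg_minP _ _ _ i1 [pred i | 0 < l i] r li1.
pose t := r i0; have t0 : 0 <= t by rewrite divr_ge0 // ltW.
pose u i := w i - t * l i.
have u0 : u i0 = 0 by rewrite /u /t /r divfK ?subrr // gt_eqF.
have ue i : 0 <= u i.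
  rewrite subr_ge0; have [li|li] := ltP 0 (l i).
    by rewrite -ler_pdivlMr //; exact: rmin.
  by apply: le_trans (w0 i); rewrite mulr_ge0_le0.
exists (fun j => u (lift i0 j)), (fun j => a (lift i0 j)); split=> //.
  transitivity (\sum_i u i); first by rewrite (bigD1_ord i0) //= u0 add0r.
  by rewrite sumrB -mulr_sumr l0 mulr0 subr0.
transitivity (\sum_i u i *: a i); last first.
  by rewrite (bigD1_ord i0) //= u0 scale0r add0r.
under [RHS]eq_bigr do rewrite scalerBl -scalerA.
by rewrite sumrB -scaler_sumr la0 scaler0 subr0.
Qed.

Theorem caratheodory A x : convex_hull A x ->
  exists2 k, (k <= n)%N & convex_comb A k.+1 x.
Proof.
have: convex_hull A `<=` [set x | exists m, convex_comb A m x].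
  apply: smallest_sub; first exact: convex_comb_convex.
  move=> y Ay; exists 1%N, (fun=> 1), (fun=> y).
  by split; rewrite ?big_ord1 ?scale1r.
move=> /[apply] -[m]; elim: m => [|m IHm] xm.
  have [w [a [_ _ ]]] := xm; rewrite big_ord0 => /esym/eqP.
  by rewrite oner_eq0.
have [mn|nm] := leqP m n; first by exists m.
exact/IHm/convex_comb_shorten.
Qed.

End Caratheodory.

(** * Upper bound: splitting a mass into points of the hull *)

Section Splitting.
Context (R : realType) (n : nat).
Implicit Types (A E : set 'rV[R]_n) (h : 'rV[R]_n -> R).

Definition splits E h (m : nat) (y : 'rV[R]_n) (B : R) : Prop :=
  exists s : seq 'rV[R]_n,
    [/\ size s = m, forall x, x \in s -> E x, \sum_(x <- s) x = y &
        \sum_(x <- s) h x <= B].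

Lemma splits0 E h : splits E h 0 0 0.
Proof. by exists [::]; split=> //; rewrite big_nil. Qed.

Lemma splits_cat E h m1 m2 y1 y2 B1 B2 :
  splits E h m1 y1 B1 -> splits E h m2 y2 B2 ->
  splits E h (m1 + m2) (y1 + y2) (B1 + B2).
Proof.
move=> [s1 [<- E1 <- h1]] [s2 [<- E2 <- h2]]; exists (s1 ++ s2).
split; rewrite ?size_cat ?big_cat ?lerD // => x.
by rewrite mem_cat => /orP[/E1|/E2].
Qed.

Lemma splits_const E h m x B :
  E x -> h x <= B -> splits E h m (x *+ m) (B *+ m).
Proof.
move=> Ex hx; exists (nseq m x); split.
- by rewrite size_nseq.
- by move=> y /nseqP[->].
- by rewrite big_nseq iter_addr_0.
- by rewrite big_nseq iter_addr_0 lerMn2r hx orbT.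
Qed.

Lemma splits_vertices A E h k (a : 'I_k -> 'rV[R]_n) (c : 'I_k -> nat) :
    A `<=` E -> (forall x, A x -> h x <= 0) -> (forall i, A (a i)) ->
  splits E h (\sum_i c i) (\sum_i a i *+ c i) 0.
Proof.
move=> AE h0 Aa.
apply: (big_ind2 (fun m y => splits E h m y 0)); first exact: splits0.
  by move=> m1 y1 m2 y2 s1 s2; have := splits_cat s1 s2; rewrite addr0.
move=> i _; rewrite -(mul0rn R (c i)).
by apply: splits_const; [exact/AE|exact/h0].
Qed.

(** Each of the [m] midpoints of consecutive points costs 1, and their values
    are otherwise bounded by half the values at the [2 * m] given points. *)
Lemma splits_half E h : convex_set E -> approximately_convex E h ->
  forall m y B, splits E h (2 * m) y B ->
    splits E h m (2^-1 *: y) (B / 2 + m%:R).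
Proof.
move=> /convex_setE cE hE; elim=> [|m IHm] y B [s [+ Es <- hB]].
  move=> /size0nil s0; rewrite s0 big_nil in hB *; exists [::].
  by split; rewrite ?big_nil ?scaler0 // addr0 divr_ge0.
case: s Es hB => [|a [|b s]] Es hB /=; [by rewrite mulnS|by rewrite mulnS|].
rewrite mulnS => -[ss]; rewrite !big_cons in hB *.
have Ea : E a by apply: Es; rewrite inE eqxx.
have Eb : E b by apply: Es; rewrite !inE eqxx orbT.
have [|t [tm Et ts ht]] := IHm (\sum_(x <- s) x) (\sum_(x <- s) h x).
  by exists s; split=> // x xs; apply: Es; rewrite !inE xs !orbT.
exists (2^-1 *: (a + b) :: t); split=> [|x||].
- by rewrite /= tm.
- rewrite inE => /predU1P[->|/Et//].
  have := cE a b 2^-1; rewrite (_ : 1 - 2^-1 = 2^-1 :> R); last by lra.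
  rewrite -scalerDr; apply => //.
  by rewrite invr_ge0 ler0n invf_le1 // ler1n.
- by rewrite big_cons ts addrA -scalerDr.
- rewrite big_cons; have := hE a b Ea Eb; rewrite -(natr1 m); lra.
Qed.

(** The integer parts of the weights are spent on points of [A], at no cost.
    The remaining [k + 1] weights are below 1, so that their sum, an integer, is
    at most [k <= n]: this is where the dimension enters. *)
Lemma splits_floor A E h k (a : 'I_k.+1 -> 'rV[R]_n) m (w : 'I_k.+1 -> R) B :
    A `<=` E -> (forall x, A x -> h x <= 0) -> (forall i, A (a i)) ->
    (k <= n)%N -> (forall i, 0 <= w i) -> \sum_i w i = m%:R ->
    (forall m' (f : 'I_k.+1 -> R), (m' <= minn m n)%N -> (forall i, 0 <= f i) ->
      \sum_i f i = m'%:R -> splits E h m' (\sum_i f i *: a i) B) ->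
  splits E h m (\sum_i w i *: a i) B.
Proof.
move=> AE h0 Aa kn w0 wm splitB.
pose c i := Num.truncn (w i); pose f i := w i - (c i)%:R.
have f0 i : 0 <= f i by rewrite subr_ge0 truncn_le.
have f1 i : f i < 1 by rewrite ltrBlDl natr1 truncnS_gt.
have cm : (\sum_i c i <= m)%N.
  by rewrite -(ler_nat R) -wm natr_sum ler_sum // => i _; rewrite truncn_le.
have fm : \sum_i f i = (m - \sum_i c i)%N%:R.
  by rewrite sumrB wm -natr_sum natrB.
have m'n : (m - \sum_i c i <= minn m n)%N.
  rewrite leq_min leq_subr -ltnS -(ltr_nat R) -fm.
  apply: (@lt_le_trans _ _ (\sum_(i < k.+1) 1)); last first.
    by rewrite sumr_const card_ord ler_nat.
  by apply: ltr_sum => //; apply/hasP; exists ord0; rewrite ?mem_index_enum.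
have -> : \sum_i w i *: a i = \sum_i a i *+ c i + \sum_i f i *: a i.
  rewrite -big_split; apply: eq_bigr => i _ /=.
  by rewrite -scaler_nat -scalerDl addrC subrK.
rewrite -(subnKC cm) -[B]add0r.
by apply: splits_cat; [exact: splits_vertices AE h0 Aa|exact: splitB].
Qed.

(** Induction on the number [N] of doublings.  When no doubling is left, the
    remaining mass is put at its barycentre, where [h] is bounded by [M]; the at
    most [n] points of this last level carry the factor
    [2 ^- N]. *)
Lemma splits_truncated_kappa A h (M : R) k (a : 'I_k.+1 -> 'rV[R]_n) :
    approximately_convex (convex_hull A) h ->
    (forall x, convex_hull A x -> h x <= M) -> 0 <= M ->
    (forall x, A x -> h x <= 0) -> (k <= n)%N -> (forall i, A (a i)) ->
  forall N m (w : 'I_k.+1 -> R), (forall i, 0 <= w i) -> \sum_i w i = m%:R ->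
  splits (convex_hull A) h m (\sum_i w i *: a i)
    (truncated_kappa R n N m + M *+ n / 2 ^+ N).
Proof.
move=> hE hM M0 hA kn Aa; set E := convex_hull A.
have AE : A `<=` E by exact: sub_gen_smallest.
have cE : convex_set (E : set (convex_lmodType 'rV[R]_n)).
  move=> x y t; rewrite !inE => Ex Ey C [cC AC].
  have := cC x y t; rewrite !inE; apply.
    by apply: Ex; split.
  by apply: Ey; split.
elim=> [|N IHN] m w w0 wm;
  apply: (splits_floor AE hA Aa kn w0 wm) => m' f m'm f0 fm.
  rewrite /truncated_kappa big_ord0 add0r divr1.
  have [m'0|m'0] := posnP m'.
    rewrite m'0; exists [::]; split=> //; rewrite big_nil ?mulrn_wge0 //.
    rewrite big1 // => i _.
    by rewrite (psumr_eq0P _ (etrans fm _)) ?scale0r ?m'0.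
  have := @convex_sum _ _ E _ f a cE (fun i => AE _ (Aa i)) f0.
  rewrite fm ltr0n => /(_ m'0) Ez.
  have := splits_const m' Ez (hM _ Ez).
  rewrite -scaler_nat scalerKV ?pnatr_eq0 -?lt0n //.
  move=> -[s [sm Es sz sh]]; exists s; split=> //; apply: le_trans sh _.
  by rewrite ler_wpMn2l //; move: m'm; rewrite leq_min => /andP[].
have f2 i : 0 <= 2 * f i by rewrite mulr_ge0.
have fm2 : \sum_i 2 * f i = (2 * m')%N%:R by rewrite -mulr_sumr fm natrM.
have [s [sm Es sz sh]] := splits_half cE hE (IHN _ _ f2 fm2).
exists s; split=> //.
  rewrite sz; under eq_bigr do rewrite -scalerA.
  by rewrite -scaler_sumr scalerA mulVf ?scale1r.
apply: le_trans sh _; have := truncated_kappaS R N m'm.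
rewrite exprSr invfM mulrA; lra.
Qed.
End Splitting.

Section UpperBound.
Context (R : realType) (n : nat).

Lemma kappa_upper_bound (A : set 'rV[R]_n) (h : 'rV[R]_n -> R) :
  (0 < n)%N -> admissible A h ->
  sup [set h x | x in convex_hull A] <= kappa R n.
Proof.
move=> n0 [[a0 Aa0] hE [M0 hM0] hA].
pose M := Num.max 0 M0.
have hM x : convex_hull A x -> h x <= M.
  by move=> Ex; rewrite le_max hM0 ?orbT //; exists x.
apply: ge_sup; first by exists (h a0), a0 => //; exact: sub_gen_smallest.
move=> _ [x /caratheodory[k kn [w [a [w0 Aa w1 ->]]]] <-].
apply/ler_addgt0Pr => e e0.
pose K := trunc_log 2 n.
have [p pe] : exists p, M *+ n / 2 ^+ (K.+1 + p) < e.
  have [p pP] := div_exp2_lt (M *+ n) e0.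
  by exists p; apply: pP; rewrite leq_addl.
have Mge0 : 0 <= M by rewrite le_max lexx.
have [s [+ _]] :=
  splits_truncated_kappa hE hM Mge0 hA kn Aa (K.+1 + p) w0 (w1 : _ = 1%:R).
case: s => [|y [|z s]] // _; rewrite !big_seq1 => <- /le_trans; apply.
rewrite truncated_kappaE // lerD //; last exact: ltW.
by rewrite gerBl divr_ge0.
Qed.

End UpperBound.

(** * Sharpness: the depth function on the simplex *)

Section DigitDepth.
Context (R : realType).
Implicit Types x y z : R.

Definition frac x : R := x - (Num.floor x)%:~R.

Lemma frac_ge0 x : 0 <= frac x.
Proof. by rewrite subr_ge0 floor_le. Qed.

Lemma frac_lt1 x : frac x < 1.
Proof. by rewrite ltrBlDl -intrD1 floorD1_gt. Qed.

Lemma fracE x (m : int) : m%:~R <= x < (m + 1)%:~R -> frac x = x - m%:~R.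
Proof. by move=> /floor_def; rewrite /frac => ->. Qed.

Lemma frac_id x : 0 <= x < 1 -> frac x = x.
Proof. by move=> x01; rewrite (@fracE x 0) ?subr0. Qed.

Lemma frac_le x : 0 <= x -> frac x <= x.
Proof. by move=> x0; rewrite gerBl ler0z floor_ge0. Qed.

Lemma frac_nat (m : nat) : frac m%:R = 0.
Proof. by rewrite (@fracE _ m) ?subrr // lexx intrD ltrDl ltr01. Qed.

Lemma fracD x y : frac (x + y) <= frac x + frac y.
Proof.
have : (Num.floor x)%:~R + (Num.floor y)%:~R <= (Num.floor (x + y))%:~R :> R.
  by rewrite -intrD ler_int floor_ge_int intrD lerD ?floor_le.
rewrite /frac; lra.
Qed.

(** If [x] has the binary digits [d_k], not all 1 from some rank on, then
    [frac (2 ^+ j * x) / 2 ^+ j] is the sum of the [d_k / 2 ^+ k] with [k > j].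
    Summing over all [j] gives the sum of the [k * d_k / 2 ^+ k]: each dyadic
    piece of [x] is weighted by the depth of the leaf that receives it in a
    binary tree. *)
Definition digit_depth (N : nat) x : R :=
  \sum_(j < N) frac (2 ^+ j * x) / 2 ^+ j.

Lemma digit_depthS_half N z :
  digit_depth N.+1 (z / 2) = frac (z / 2) + digit_depth N z / 2.
Proof.
rewrite /digit_depth big_ord_recl expr0 mul1r divr1 mulr_suml; congr (_ + _).
apply: eq_bigr => j _; rewrite lift0.
have -> : 2 ^+ j.+1 * (z / 2) = 2 ^+ j * z by rewrite exprS; field.
by rewrite exprSr invfM mulrA.
Qed.

Lemma digit_depth_le N z : digit_depth N z <= digit_depth N.+1 z.
Proof.
by rewrite /digit_depth big_ord_recr lerDl divr_ge0 ?frac_ge0 ?exprn_ge0.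
Qed.

Lemma digit_depthD N x y :
  digit_depth N (x + y) <= digit_depth N x + digit_depth N y.
Proof.
rewrite -big_split; apply: ler_sum => j _ /=.
by rewrite -mulrDl ler_pM2r ?invr_gt0 ?exprn_gt0 // mulrDr fracD.
Qed.

(** Halving pushes all digits one level down, which costs the mass
    [(x + y) / 2]; adding before halving costs nothing, by subadditivity.  The
    level lost in [digit_depthS_half] is harmless because the truncated sums
    increase with [N]. *)
Lemma digit_depth_midpoint N x y : 0 <= x -> 0 <= y ->
  digit_depth N ((x + y) / 2) <=
    (digit_depth N x + digit_depth N y) / 2 + (x + y) / 2.
Proof.
move=> x0 y0; have xy0 : 0 <= (x + y) / 2 by rewrite divr_ge0 ?addr_ge0.
case: N => [|N]; first by rewrite /digit_depth !big_ord0 addr0 mul0r add0r.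
rewrite digit_depthS_half; have := frac_le xy0; have := digit_depthD N x y.
have := digit_depth_le N x; have := digit_depth_le N y; lra.
Qed.

Lemma digit_depth_nat N (m : nat) : digit_depth N m%:R = 0.
Proof.
by apply: big1 => j _; rewrite -natrX -natrM frac_nat mul0r.
Qed.

Lemma digit_depth_ub N x : digit_depth N x <= N%:R.
Proof.
rewrite -[leRHS]mulr1 mulr_natl -[N in leRHS]card_ord -sumr_const.
apply: ler_sum => j _; rewrite ler_pdivrMr ?exprn_gt0 // mul1r.
by rewrite (le_trans (ltW (frac_lt1 _))) // exprn_ege1 // ler1n.
Qed.

End DigitDepth.

Section LowerBound.
Context (R : realType) (n : nat).
Implicit Types x : 'rV[R]_n.

Definition simplex_vertices : set 'rV[R]_n :=
  [set x | x = 0 \/ exists i, x = delta_mx 0 i].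

Definition coord0 x : R := 1 - \sum_i x 0 i.

Definition total_depth (N : nat) x : R :=
  digit_depth N (coord0 x) + \sum_i digit_depth N (x 0 i).

Lemma simplex_coord_ge0 x : convex_hull simplex_vertices x ->
  0 <= coord0 x /\ forall i, 0 <= x 0 i.
Proof.
move: x; apply: smallest_sub.
  apply/convex_setE => x y t /andP[t0 t1] [x0 xi] [y0 yi]; split; last first.
    by move=> i; rewrite !mxE addr_ge0 // mulr_ge0 // subr_ge0.
  suff -> : coord0 (t *: x + (1 - t) *: y) = t * coord0 x + (1 - t) * coord0 y.
    by rewrite addr_ge0 // mulr_ge0 // subr_ge0.
  rewrite /coord0; under eq_bigr do rewrite !mxE.
  by rewrite big_split -!mulr_sumr /=; ring.
move=> x [->|[i ->]]; rewrite /coord0.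
  by split=> [|i]; [rewrite big1 ?subr0 // => i _|]; rewrite mxE.
split=> [|j]; last by rewrite mxE ler0n.
rewrite (bigD1 i) //= big1 ?mxE ?eqxx ?addr0 ?subrr // => j ji.
by rewrite mxE (negbTE ji).
Qed.

Lemma simplex_hull x : 0 <= coord0 x -> (forall i, 0 <= x 0 i) ->
  convex_hull simplex_vertices x.
Proof.
move=> x0 xi C [cC vC].
pose w (o : option 'I_n) := if o is Some i then x 0 i else coord0 x.
pose a (o : option 'I_n) : 'rV[R]_n := if o is Some i then delta_mx 0 i else 0.
have sumE (V : nmodType) (F : option 'I_n -> V) :
    \sum_o F o = F None + \sum_i F (Some i).
  rewrite (bigD1 None) //=; congr (_ + _).
  rewrite (reindex_omap Some id) //=.
  by apply: eq_bigl => i; rewrite eqxx.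
  by case.
have w1 : \sum_o w o = 1 by rewrite sumE /= /coord0 subrK.
have wa : \sum_o w o *: a o = x.
  by rewrite sumE /= scaler0 add0r [RHS]row_sum_delta.
rewrite -wa -[X in C X]scale1r -[1 in X in C X]invr1 -w1.
apply: convex_sum => //.
- by case=> [i|]; apply: vC; [right; exists i|left].
- by case.
- by rewrite w1 ltr01.
Qed.

(** The midpoint inequalities of the [n + 1] barycentric coordinates add up, and
    the error terms [(x + y) / 2] then have sum 1. *)
Lemma total_depth_admissible N : admissible simplex_vertices (total_depth N).
Proof.
split.
- by exists 0; left.
- move=> x y /simplex_coord_ge0[x0 xi] /simplex_coord_ge0[y0 yi].
  have := digit_depth_midpoint N x0 y0.
  have -> : (coord0 x + coord0 y) / 2 = coord0 (2^-1 *: (x + y)).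
    rewrite /coord0; under [in RHS]eq_bigr do rewrite !mxE.
    by rewrite -mulr_sumr big_split /=; lra.
  have : \sum_i digit_depth N ((2^-1 *: (x + y)) 0 i) <=
      (\sum_i digit_depth N (x 0 i) + \sum_i digit_depth N (y 0 i)) / 2 +
      \sum_i (2^-1 *: (x + y)) 0 i.
    rewrite -big_split mulr_suml -big_split /=; apply: ler_sum => i _.
    by rewrite !mxE [2^-1 * _]mulrC digit_depth_midpoint.
  rewrite /total_depth {4}/coord0; lra.
- exists (N%:R + \sum_(i < n) N%:R) => _ [x _ <-].
  by rewrite lerD ?digit_depth_ub // ler_sum // => i _; exact: digit_depth_ub.
- have w0 := digit_depth_nat R N 0; have w1 := digit_depth_nat R N 1.
  move=> x [->|[i ->]]; rewrite /total_depth /coord0.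
    rewrite !big1 ?subr0 ?w1 ?addr0 // => i _; rewrite mxE //.
  rewrite [X in 1 - X](bigD1 i) //= big1 => [|j ji]; last first.
    by rewrite mxE (negbTE ji).
  rewrite mxE !eqxx addr0 subrr w0 add0r big1 // => j _.
  by rewrite mxE eqxx /=; case: (j == i).
Qed.

(** With [k = trunc_log 2 n], the inequalities [n < 2 ^ k.+1 <= 2 * n] make
    [2 ^ k.+1] a sum of [n] terms [c i] equal to 1 or 2.  The coordinates of the
    extremal point are [c i / 2 ^+ k.+1 - d], which leaves [n * d] for the last
    barycentric coordinate.  The shift [d > 0] is so small that
    [2 ^+ j * (n * d)] stays below 1 for all levels [j] in use; its role is to
    replace the integers [c i * 2 ^ (j - k.+1)] by numbers of fractional part
    close to 1. *)
Lemma total_depth_extremal p : (0 < n)%N ->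
  exists2 x, convex_hull simplex_vertices x &
    total_depth ((trunc_log 2 n).+1 + p) x =
    truncated_kappa R n ((trunc_log 2 n).+1 + p) 1.
Proof.
move=> n0; have /andP[lo hi] := trunc_log_bounds (isT : (1 < 2)%N) n0.
set k := trunc_log 2 n in lo hi *; set N := (k.+1 + p)%N.
pose s := (2 ^ k.+1 - n)%N.
have sn : (s <= n)%N by rewrite leq_subLR addnn -mul2n expnS leq_mul2l.
pose c (i : 'I_n) : nat := if (i < s)%N then 2 else 1.
have c2 i : (c i <= 2)%N by rewrite /c; case: ifP.
have c1 i : (1 <= c i)%N by rewrite /c; case: ifP.
have cs : (\sum_i c i = 2 ^ k.+1)%N.
  transitivity (\sum_(i < n) (1 + (i < s)))%N.
    by apply: eq_bigr => i _; rewrite /c; case: ifP.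
  rewrite big_split /= sum1_card card_ord.
  have -> : (\sum_(i < n) (i < s) = \sum_(i < n | i < s) 1)%N.
    by rewrite [RHS]big_mkcond; apply: eq_bigr => i _ /=; case: ifP.
  rewrite -(big_ord_widen n (fun=> 1%N) sn) sum1_card card_ord.
  by rewrite subnKC // ltnW.
pose d : R := (2 ^+ N * n.+1%:R)^-1.
have two0 j : 0 < (2 : R) ^+ j by rewrite exprn_gt0.
have d0 : 0 < d by rewrite invr_gt0 mulr_gt0.
have dN : d * n.+1%:R = (2 ^+ N)^-1 by rewrite /d invfM mulfVK // pnatr_eq0.
have dj j : (j <= N)%N -> 2 ^+ j * (n%:R * d) < 1.
  move=> jN; apply: (@lt_le_trans _ _ (2 ^+ j * (n.+1%:R * d))).
    by rewrite !ltr_pM2l // ltr_pM2r // ltr_nat.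
  rewrite mulrC [n.+1%:R * d]mulrC dN mulrC ler_pdivrMr // mul1r.
  by rewrite ler_weXn2l // ler1n.
have dj1 j : (j <= N)%N -> 2 ^+ j * d < 1.
  move=> /dj; apply: le_lt_trans; rewrite ler_pM2l // ler_peMl ?(ltW d0) //.
  by rewrite ler1n.
pose x : 'rV[R]_n := \row_i ((c i)%:R / 2 ^+ k.+1 - d).
have xiE i : x 0 i = (c i)%:R / 2 ^+ k.+1 - d by rewrite mxE.
have xs : \sum_i x 0 i = 1 - n%:R * d.
  under eq_bigr do rewrite xiE.
  rewrite sumrB -mulr_suml -natr_sum cs natrX divff ?gt_eqF //.
  by rewrite sumr_const card_ord mulr_natl.
have x0E : coord0 x = n%:R * d by rewrite /coord0 xs opprB addrC subrK.
have xi0 i : 0 <= x 0 i.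
  rewrite xiE subr_ge0 ler_pdivlMr // mulrC.
  apply: le_trans (ltW (dj1 k.+1 _)) _; first exact: leq_addr.
  by rewrite ler1n.
have x00 : 0 <= coord0 x by rewrite x0E mulr_ge0 // ltW.
exists x; first exact: simplex_hull.
rewrite /total_depth /digit_depth exchange_big -big_split /=.
apply: eq_bigr => -[j jN] _ /=; rewrite -mulr_suml -mulrDl muln1; congr (_ / _).
rewrite (frac_id (_ : 0 <= 2 ^+ j * coord0 x < 1)); last first.
  by rewrite mulr_ge0 ?exprn_ge0 //= x0E dj // ltnW.
(* For [j <= k] the coordinates times [2 ^+ j] are below 1, and they equal their
   fractional parts. *)
have [jk|kj] := leqP j k.
  rewrite (minn_idPl _); last by apply: leq_trans lo; rewrite leq_exp2l.
  rewrite (eq_bigr (fun i => 2 ^+ j * x 0 i)) => [|i _].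
    by rewrite -mulr_sumr -mulrDr /coord0 subrK mulr1 natrX.
  apply: frac_id; rewrite mulr_ge0 ?exprn_ge0 //= xiE mulrBr.
  rewrite ltrBlDr; apply: (@le_lt_trans _ _ 1); last by rewrite ltrDl mulr_gt0.
  rewrite mulrA ler_pdivrMr // mul1r exprSr ler_pM // ?exprn_ge0 ?ler_nat //.
  by rewrite ler_weXn2l // ler1n.
rewrite (minn_idPr _); last first.
  by apply: leq_trans (ltnW hi) _; rewrite leq_exp2l.
rewrite (eq_bigr (fun=> 1 - 2 ^+ j * d)) => [|i _].
  by rewrite sumr_const card_ord x0E -mulr_natl; ring.
have E : 2 ^+ j * x 0 i = (c i * 2 ^ (j - k.+1))%N%:R - 2 ^+ j * d.
  rewrite xiE mulrBr natrM natrX; congr (_ - _).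
  by rewrite -[in LHS](subnK kj) exprD; field; rewrite gt_eqF.
have c0 : (0 < c i * 2 ^ (j - k.+1))%N by rewrite muln_gt0 c1 expn_gt0.
(* The integer part is one less than the integer just above. *)
rewrite E (@fracE _ _ (c i * 2 ^ (j - k.+1))%N.-1%:Z).
  by rewrite -[in LHS](prednK c0) -natr1 /=; ring.
rewrite -PoszD addn1 prednK // -[in X in X && _](prednK c0) -natr1 /=.
rewrite -!pmulrn gtrBl mulr_gt0 // andbT.
have := dj1 j (ltnW jN); lra.
Qed.

Lemma kappa_sharp (c : R) : (0 < n)%N -> c < kappa R n ->
  exists (A : set 'rV[R]_n) h,
    admissible A h /\ c < sup [set h x | x in convex_hull A].
Proof.
move=> n0; rewrite -subr_gt0 => cn.
pose k := trunc_log 2 n.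
have [p pP] := div_exp2_lt n%:R cn.
have [x Ex xE] := total_depth_extremal p n0.
exists simplex_vertices, (total_depth (k.+1 + p)).
have adm := total_depth_admissible (k.+1 + p); split=> //.
have [_ _ ub _] := adm.
apply: (@lt_le_trans _ _ (total_depth (k.+1 + p) x)); last first.
  by apply: ub_le_sup => //; exists x.
rewrite xE truncated_kappaE //; have := pP (k + p)%N (leq_addl _ _); lra.
Qed.

End LowerBound.

Theorem theorem2p3 (R : realType) (n : nat) (n_ge1 : (1 <= n)%N) :
  (forall (A : set 'rV[R]_n) (h : 'rV[R]_n -> R), admissible A h ->
     sup [set h x | x in convex_hull A] <= kappa R n) /\
  (forall c : R, c < kappa R n ->
     ~ (forall (A : set 'rV[R]_n) (h : 'rV[R]_n -> R), admissible A h ->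
          sup [set h x | x in convex_hull A] <= c)).
Proof.
split=> [A h|c /(kappa_sharp n_ge1)[A [h [Ah ch]]] /(_ A h Ah)].
  exact: kappa_upper_bound.
by rewrite leNgt ch.
Qed.
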